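(* Let $G=(V,E)$ be a finite simple bipartite graph with maximum degree $\Delta$, let $k\ge\Delta$, and let $M(G,k)$ be the Markov chain on the edge $k$-colorings of $G$ defined in the context. Then the inverse of the acceptance ratio in the Metropolis-Hastings algorithm applied with a constant function $g$ (i.e. with the uniform target distribution on edge $k$-colorings of $G$) and with the Markov chain $M(G,k)$ is upper bounded by $96|V|^2(|V|-1)$.
   Context: **Colorings.** An edge $k$-coloring of $G=(V,E)$ is a map $C:E\to\{c_1,\dots,c_k\}$ such that no two adjacent edges have the same color. For a map $C:E\to\{c_1,\dots,c_k\}$, a vertex $v$ has a $(+c-c')$-deficiency (and is called deficient) if exactly two $c$-colored edges are incident to $v$, all other edges incident to $v$ have different colors, and no $c'$-colored edge is incident to $v$. An almost edge $k$-coloring is a map $C:E\to\{c_1,\dots,c_k\}$ such that at most two vertices have deficiency and all other vertices have no two incident edges of the same color. Flipping the colors along an alternating path, walk or cycle with colors $a,b$ means interchanging $a$ and $b$ on its edges. Eliminating a $(+a-b)$-deficiency at a vertex $v$ means: select uniformly one of the two $a$-edges at $v$ and flip the colors along the appropriate maximal alternating path (walk) with colors $a,b$ starting at $v$ with the selected edge. **The Markov chain $M(G,k)$.** $G$ is bipartite and $k\ge\Delta$. The states are the edge $k$-colorings of $G$. From the current coloring $C$, a random edge $k$-coloring is drawn as follows. (1) With probability $\frac12$, do nothing. (2) With probability $\frac14$, select two colors $c,c'$ uniformly among the $\binom{k}{2}$ unordered pairs. Let $H$ be the subgraph of $G$ formed by the edges of colors $c$ and $c'$; its non-trivial components are paths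 and cycles. Select one of the following: (a) with probability $\frac13$, do nothing; (b) with probability $\frac13$, uniformly select a sub-path or a cycle of $H$ from all sub-paths and cycles in $H$; (c) with probability $\frac13$, uniformly select two sub-paths of $H$ from all possible pairs of sub-paths such that both of them have exactly one end vertex which is also an end vertex in $H$. Flip the colors in the selected sub-paths (or cycle). If there is any deficient vertex, select one of them uniformly, then select uniformly one of the edges with the same color incident to the selected vertex and change its color from $c$ to $c'$ or from $c'$ to $c$. Otherwise, with probability $\frac12$ select an edge uniformly from all edges of color $c$ or $c'$ and change its color to the opposite ($c'$ or $c$), and with probability $\frac12$ do nothing. Finally eliminate all deficiencies by flipping the colors on appropriate alternating paths, selecting uniformly from the two edges with the same color incident to a deficient vertex. (3) With probability $\frac14$, select three colors uniformly from all $\binom{k}{3}$ unordered triples, and select uniformly one of the three as distinguished. Let $c''$ be the distinguished color and $c,c'$ the other two. Let $H$ be the subgraph consisting of the edges of colors $c$ and $c'$; its non-trivial components are paths and cycles. Select one of the following: (a) with probability $\frac13$, do nothing; (b) with probability $\frac13$, uniformly select a sub-path of $H$ from all sub-paths such that at least one of its end vertices is not an end vertex in $H$; (c) with probability $\frac13$, uniformly select two sub-paths of $H$ from all possible pairs of sub-paths such that both of them have exactly one end vertex which is also an end vertex in $H$. Flip the colors in the selected sub-paths. If there are two deficient vertices, select one of them uniformly. If there is only one deficient vertex, then with probability $\frac12$ select it, and with probability $\frac12$ select uniformly a non-deficient vertex among those incident to both a $c''$-edge and at least one of a $c$- or a $c'$-edge. If there is no deficient vertex, select uniformly a non-deficient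 vertex among those incident to both a $c''$-edge and at least one of a $c$- or a $c'$-edge. - If a deficient vertex is selected, select uniformly one of the edges with the same color incident to it, and let this color be $\tilde c$. Consider the maximal alternating path or cycle with colors $\tilde c$ and $c''$ containing the selected edge, and flip the colors in it. - If a non-deficient vertex is selected, let $e$ be its incident edge of color $c''$ and $f$ its incident edge of color $c$ or $c'$ (if it has incident edges of both colors, one of them is selected uniformly), and let $\tilde c$ be the color of $f$. Take the maximal alternating path with colors $c''$ and $\tilde c$ that contains $e$ but does not contain $f$, and flip the colors in it. Finally eliminate all deficiencies by flipping the colors on appropriate alternating paths, selecting uniformly from the two edges with the same color incident to a deficient vertex. **Metropolis-Hastings algorithm (variant used).** Given a positive function $g$ on the states, a proposal $y$ is drawn from the current state $x$ by the primary chain via some way $w$ among the several possible ways $w_1,\dots,w_t$ to transform $x$ to $y$; there is a one-to-one map $w_i\mapsto w_i'$ onto the ways of transforming $y$ back to $x$. $P(y,w\mid x)$ denotes the probability that $y$ is proposed from $x$ via way $w$. The proposal is accepted with probability $\min\left\{1,\frac{g(y)P(x,w'\mid y)}{g(x)P(y,w\mid x)}\right\}$ and otherwise the chain stays at $x$. For $g$ constant and states $C_1,C_2$, the Metropolis-Hastings ratio is $\frac{P(C_1,w'\mid C_2)}{P(C_2,w\mid C_1)}$. A way $w$ of transforming $C_1$ into $C_2$ in $M(G,k)$ consists of the selection of 2 or 3 colors (with the distinguished color if there are 3), followed by three consecutive transformations: $\varphi_1^{-1}$ (flipping the colors on the selected sub-paths or cycle, which creates at most two deficient vertices), $f$ (the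 subsequent perturbation, i.e. the change of color of one edge, the flip along a path or cycle involving $c''$, or nothing), and $\varphi_2$ (elimination of all deficiencies); the inverse way $w'$ selects the same colors and applies $\varphi_2^{-1}$, $f^{-1}$, $\varphi_1$. If nothing is done, the ratio is $1$. The bound on the inverse of the acceptance ratio means that for all states $C_1,C_2$ and every way $w$ by which $C_2$ can be proposed from $C_1$ the inverse of the acceptance probability is at most the stated quantity.
   Formalization: Assumes |V| ≥ 2 (for |V| ≤ 1 the bound is 0 and fails) and that the inverse way w' has positive probability of proposing C1 from C2; for some ways of the chain as written it is 0, so the acceptance probability is 0 and its inverse is undefined. *)

(* Defs.v *)
From mathcomp Require Import all_boot all_order perm all_algebra.
From mathcomp Require Import boolp.
Set Implicit Arguments.
Unset Strict Implicit.
Unset Printing Implicit Defensive.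
Import Order.TTheory GRing.Theory Num.Theory.
Local Open Scope ring_scope.

Record sgraph := SGraph {
  vertex :> finType;
  adj : rel vertex;
  adj_sym : symmetric adj;
  adj_irr : irreflexive adj
}.

Definition bipartite (G : sgraph) : Prop :=
  exists A : {set G}, forall u v, adj u v -> (u \in A) != (v \in A).

Definition max_degree (G : sgraph) : nat :=
  (\max_(v : G) #|[set u : G | adj v u]|)%N.

Definition edge (G : sgraph) : finType :=
  {x : {set G} | [exists u, exists v, adj u v && (x == [set u; v])]}.

Definition endpoints (G : sgraph) (e : edge G) : {set G} := val e.

Notation color_map G k := {ffun edge G -> 'I_k}.

Section Distributions.
Variable T : finType.

Definition dirac (x : T) : T -> rat := fun y => (x == y)%:R.

(* Draw i uniformly from A and continue with F i; if A is empty the draw is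
   impossible and x is left unchanged. *)
Definition unif (I : finType) (x : T) (A : {set I}) (F : I -> T -> rat) :
    T -> rat :=
  fun y => if A == set0 then dirac x y else (\sum_(i in A) F i y) / #|A|%:R.

End Distributions.

Section Walks.
Variable G : sgraph.
Implicit Types (v x : G) (e : edge G) (es : seq (edge G)) (H S : {set edge G}).

Definition other x e : G := odflt x [pick y in endpoints e :\ x].

(* A walk is a starting vertex x with its sequence of edges es; the vertices
   visited after x are scanl other x es. *)
Fixpoint walk x es : bool :=
  if es is e :: es' then (x \in endpoints e) && walk (other x e) es' else true.

Definition spath x es : bool :=
  [&& es != [::], walk x es & uniq (x :: scanl other x es)].

Definition scycle x es : bool :=
  [&& es != [::], walk x es, uniq es, uniq (scanl other x es)
    & last x (scanl other x es) == x].

(* Paths and cycles are undirected subgraphs, hence represented by their edge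
   sets; paths have at least one edge. *)
Definition subpaths H : {set {set edge G}} :=
  [set S : {set edge G} | (S \subset H) &&
    `[< exists x es, spath x es /\ S = [set e in es] >]].

Definition subcycles H : {set {set edge G}} :=
  [set S : {set edge G} | (S \subset H) &&
    `[< exists x es, scycle x es /\ S = [set e in es] >]].

Definition ends S : {set G} := [set v : G | #|[set e : edge G in S | v \in endpoints e]| == 1%N].

Definition one_end_paths H : {set {set edge G}} :=
  [set S in subpaths H | #|ends S :&: ends H| == 1%N].

Definition inner_end_paths H : {set {set edge G}} :=
  [set S in subpaths H | ~~ (ends S \subset ends H)].

Definition path_pairs H : {set {set {set edge G}}} :=
  [set P : {set {set edge G}} | (#|P| == 2%N) && (P \subset one_end_paths H)].

(* Two sub-paths of a pair may overlap: flipping both of them flips twice, i.e.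
   leaves unchanged, the edges that they share. *)
Definition flipped_edges (P : {set {set edge G}}) : {set edge G} :=
  [set e : edge G | odd #|[set S in P | e \in S]|].

End Walks.

Section Colorings.
Variables (G : sgraph) (k : nat).
Implicit Types (C K : color_map G k) (a b d : 'I_k).
Implicit Types (v x : G) (e f : edge G) (es : seq (edge G)) (S : {set edge G}).

Definition edge_coloring C : bool :=
  [forall e : edge G, forall e' : edge G,
    (e != e') && ~~ [disjoint endpoints e & endpoints e'] ==> (C e != C e')].

Definition flip C a b S : color_map G k :=
  [ffun e => if e \in S then tperm a b (C e) else C e].

Definition color_edges C a b : {set edge G} :=
  [set e : edge G | (C e == a) || (C e == b)].

Definition edges_at C v a : {set edge G} :=
  [set e : edge G | (v \in endpoints e) && (C e == a)].

(* v has a (+a-b)-deficiency *)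
Definition deficiency C v a b : bool :=
  [&& #|edges_at C v a| == 2%N,
      [forall d, (d != a) ==> (#|edges_at C v d| <= 1)%N]
    & edges_at C v b == set0].

Definition deficients C : {set G} :=
  [set v : G | [exists a, exists b, deficiency C v a b]].

(* the two edges of equal colour at a deficient vertex *)
Definition dup_edges C v : {set edge G} :=
  [set e : edge G | [exists a, exists b, deficiency C v a b && (e \in edges_at C v a)]].

Definition alternating C a b es : bool :=
  all (fun e => C e \in [:: a; b]) es && sorted (fun e e' => C e != C e') es.

Definition alt_path C a b S : bool :=
  `[< exists x es, [/\ spath x es, alternating C a b es & S = [set e in es]] >].

Definition alt_cycle C a b S : bool :=
  `[< exists x es, [/\ scycle x es, all (fun e => C e \in [:: a; b]) es,
        cycle (fun e e' => C e != C e') es & S = [set e in es]] >].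

Definition alt_trail C a b x e S : bool :=
  `[< exists es, [/\ ohead es = Some e, walk x es, uniq es,
        alternating C a b es & S = [set e in es]] >].

Definition max_alt_paths_cycles C a b e : {set {set edge G}} :=
  [set S : {set edge G} |
    maxset (fun S => (alt_path C a b S || alt_cycle C a b S) && (e \in S)) S].

Definition max_alt_paths_avoiding C a b e f : {set {set edge G}} :=
  [set S : {set edge G} |
    maxset (fun S => [&& alt_path C a b S, e \in S & f \notin S]) S].

Definition max_alt_trails C a b x e : {set {set edge G}} :=
  [set S : {set edge G} | maxset (alt_trail C a b x e) S].

End Colorings.

Section Chain.
Variables (G : sgraph) (k : nat).
Local Notation coloring := (color_map G k).
Implicit Types (C K : coloring) (a b c : 'I_k) (v : G) (e f : edge G).

(* pickV chooses the next deficient vertex to be repaired, the order of repair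
   being unspecified in the chain.  pickP chooses "the"
   maximal alternating path: it is unique unless a deficient vertex offers two
   continuations. *)
Variables (pickV : coloring -> {set G} -> G)
          (pickP : coloring -> {set {set edge G}} -> {set edge G}).

(* v may lack several colours; the deficiency eliminated is (+a-b) for the first
   colour b of palette missing at v.  Palettes list the distinguished colour
   last, so that deficiencies created by flips in c, c' are eliminated in the
   colours c, c'. *)
Definition elim_step (palette : seq 'I_k) K : coloring -> rat :=
  let D := deficients K in
  if D == set0 then dirac K else
  let v := pickV K D in
  unif K (dup_edges K v) (fun e =>
    let a := K e in
    let b := head a [seq b <- palette | deficiency K v a b] in
    dirac (flip K a b (pickP K (max_alt_trails K a b v e)))).

Fixpoint elim_steps (palette : seq 'I_k) (n : nat) K : coloring -> rat :=
  if n is n'.+1 then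
    fun C => \sum_K' elim_step palette K K' * elim_steps palette n' K' C
  else dirac K.

(* Repeat until no vertex is deficient: elim_step is idle once this holds. *)
Definition eliminate (palette : seq 'I_k) : coloring -> coloring -> rat :=
  elim_steps palette #|G|.

Definition select2 c c' C : coloring -> rat := fun K =>
  let H := color_edges C c c' in
  3^-1 * dirac C K
  + 3^-1 * unif C (subpaths H :|: subcycles H)
             (fun S => dirac (flip C c c' S)) K
  + 3^-1 * unif C (path_pairs H)
             (fun P => dirac (flip C c c' (flipped_edges P))) K.

Definition select3 c c' C : coloring -> rat := fun K =>
  let H := color_edges C c c' in
  3^-1 * dirac C K
  + 3^-1 * unif C (inner_end_paths H) (fun S => dirac (flip C c c' S)) K
  + 3^-1 * unif C (path_pairs H)
             (fun P => dirac (flip C c c' (flipped_edges P))) K.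

Definition perturb2 c c' K : coloring -> rat := fun K' =>
  let D := deficients K in
  let recolor e := dirac (flip K c c' [set e]) in
  if D != set0 then
    unif K D (fun v => unif K (dup_edges K v) recolor) K'
  else 2^-1 * unif K (color_edges K c c') recolor K' + 2^-1 * dirac K K'.

Definition perturb3_deficient c'' K v : coloring -> rat :=
  unif K (dup_edges K v) (fun e =>
    dirac (flip K (K e) c'' (pickP K (max_alt_paths_cycles K (K e) c'' e)))).

Definition candidates c c' c'' K : {set G} :=
  [set v : G | [&& v \notin deficients K, edges_at K v c'' != set0
             & edges_at K v c :|: edges_at K v c' != set0]].

Definition perturb3_nondeficient c c' c'' K : coloring -> rat :=
  unif K (candidates c c' c'' K) (fun v =>
  unif K (edges_at K v c'') (fun e =>
  unif K (edges_at K v c :|: edges_at K v c') (fun f =>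
    dirac (flip K c'' (K f)
             (pickP K (max_alt_paths_avoiding K c'' (K f) e f)))))).

Definition perturb3 c c' c'' K : coloring -> rat := fun K' =>
  let D := deficients K in
  if (1 < #|D|)%N then unif K D (perturb3_deficient c'' K) K'
  else if #|D| == 1%N then
    2^-1 * unif K D (perturb3_deficient c'' K) K'
    + 2^-1 * perturb3_nondeficient c c' c'' K K'
  else perturb3_nondeficient c c' c'' K K'.

(* A way from C1 to C2: the selected colours together with the successive
   transformations C1 -> K1 -> K2 -> C2, recorded by the two intermediate maps
   K1 and K2.  An unordered pair of colours is encoded by c < c', and the last
   colour of a triple is the distinguished one. *)
Inductive way : Type :=
| Idle
| Way2 of 'I_k & 'I_k & coloring & coloring
| Way3 of 'I_k & 'I_k & 'I_k & coloring & coloring.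

Definition inverse_way (w : way) : way :=
  match w with
  | Idle => Idle
  | Way2 c c' K1 K2 => Way2 c c' K2 K1
  | Way3 c c' c'' K1 K2 => Way3 c c' c'' K2 K1
  end.

(* P(C2, w | C1) *)
Definition proposal_prob (w : way) C1 C2 : rat :=
  match w with
  | Idle => 2^-1 * dirac C1 C2
  | Way2 c c' K1 K2 =>
      if (c < c')%N then
        4^-1 * ('C(k, 2)%:R)^-1
        * (select2 c c' C1 K1 * perturb2 c c' K1 K2
           * eliminate [:: c; c'] K2 C2)
      else 0
  | Way3 c c' c'' K1 K2 =>
      if [&& (c < c')%N, c'' != c & c'' != c'] then
        4^-1 * ('C(k, 3)%:R)^-1 * 3^-1
        * (select3 c c' C1 K1 * perturb3 c c' c'' K1 K2
           * eliminate [:: c; c'; c''] K2 C2)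
      else 0
  end.

End Chain.

Definition MH_acceptance (T W : Type) (P : W -> T -> T -> rat) (inv : W -> W)
    (g : T -> rat) (w : W) (x y : T) : rat :=
  Num.min 1 ((g y * P (inv w) y x) / (g x * P w x y)).

(* Main.v *)
(** In the quotient of the probabilities of a way and of its inverse the factors
    for the choice of colours cancel, and the rest of the numerator is at most 1.
    So it suffices to bound the probability of the inverse way
    C2 -> K2 -> K1 -> C1 from below.  The subgraph H of two colours has degree at
    most 2, so a sub-path or cycle is determined by its start, its first edge and
    its length, and a sub-path with exactly one end at an end of H by its other
    end and its first edge: there are at most 2|V|^2 sub-paths and cycles, and at
    most 2|V|^2 pairs.  At most two deficiencies are created, and by bipartiteness
    each elimination repairs a vertex without damaging another one, so that the
    elimination has probability at least 1/4.  If K2 has a deficient vertex, the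
    three steps contribute 1/(6|V|^2), 1/(4(|V|-1)) and 1/4; otherwise K2 = C2,
    and they contribute 1/3, 1/(4|V|) and 1/4. *)

Require Import Defs.
From mathcomp Require Import all_boot all_order perm all_algebra.
From mathcomp Require Import boolp lra zify ring.
Set Implicit Arguments.
Unset Strict Implicit.
Unset Printing Implicit Defensive.
Import Order.TTheory GRing.Theory Num.Theory.
Local Open Scope ring_scope.

(** Allows counting by codes that are not functions of the coded object: an undirected path may be
    coded from either of its ends. A choice of one code for each element is an injection. *)
Lemma leq_card_rel (S T : finType) (A : {set S}) (B : {set T})
    (R : S -> T -> Prop) :
  (forall x, x \in A -> exists2 y, y \in B & R x y) ->
  (forall x x' y, R x y -> R x' y -> x = x') ->
  (#|A| <= #|B|)%N.
Proof.
move=> exR injR; have [->|[x0 Ax0]] := set_0Vmem A; first by rewrite cards0.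
have [y0 _ _] := exR _ Ax0.
pose f x := odflt y0 [pick y in B | `[< R x y >]].
have fP x : x \in A -> f x \in B /\ R x (f x).
  move=> Ax; rewrite /f; case: pickP => [y /andP[By /asboolP] //|none].
  have [y By Rxy] := exR _ Ax.
  by have := none y; rewrite By; case: asboolP.
have injf : {in A &, injective f}.
  move=> x x' /fP[_ Rx] /fP[_ Rx'] fE; apply: injR Rx _; by rewrite fE.
rewrite -(card_in_imset injf); apply/subset_leq_card/subsetP => _ /imsetP[x Ax ->].
by have [] := fP _ Ax.
Qed.

(** * Trails in subgraphs of maximum degree two *)

Section Trails.
Variable G : sgraph.
Implicit Types (x y z u : G) (e f : edge G) (es : seq (edge G)).
Implicit Types (H S : {set edge G}).

Lemma endpoints_other x e : x \in endpoints e ->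
  [/\ endpoints e = [set x; other x e], adj x (other x e) & other x e != x].
Proof.
move=> xe; suff [y [eE xy yx]] : exists y,
    [/\ endpoints e = [set x; y], adj x y & y != x].
  suff -> : other x e = y by [].
  rewrite /other; case: pickP => [z|/(_ y)]; rewrite eE !inE ?yx ?eqxx ?orbT //.
  by case/andP=> /negPf->/eqP.
move: xe; rewrite /endpoints.
have /existsP[u /existsP[v /andP[uv /eqP->]]] := valP e.
have vu : v != u by apply: contraTneq uv => ->; rewrite adj_irr.
rewrite !inE => /orP[] /eqP->; first by exists v.
by exists u; rewrite setUC adj_sym eq_sym.
Qed.

Lemma other_endpoint x e : x \in endpoints e -> other x e \in endpoints e.
Proof. by move=> /endpoints_other[-> _ _]; rewrite !inE eqxx orbT. Qed.

Lemma endpointE x y e : x \in endpoints e ->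
  (y \in endpoints e) = (y == x) || (y == other x e).
Proof. by move=> /endpoints_other[-> _ _]; rewrite !inE. Qed.

Lemma otherK x e : x \in endpoints e -> other (other x e) e = x.
Proof.
move=> xe; have [_ _ /negPf ne] := endpoints_other xe.
have oe := other_endpoint xe; move: (xe); rewrite (endpointE x oe).
by rewrite eq_sym ne => /eqP/esym.
Qed.

Definition tip x es : G := foldl (@other G) x es.

Lemma walk_cat x es es' : walk x (es ++ es') = walk x es && walk (tip x es) es'.
Proof. by elim: es x => //= e es IHes x; rewrite IHes andbA. Qed.

Lemma tip_cat x es es' : tip x (es ++ es') = tip (tip x es) es'.
Proof. exact: foldl_cat. Qed.

Lemma walk_rev x es : walk x es ->
  walk (tip x es) (rev es) /\ tip (tip x es) (rev es) = x.
Proof.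
elim: es x => [|e es IHes] //= x /andP[xe /IHes[wr tr]].
rewrite rev_cons -cats1 walk_cat tip_cat /= wr tr /=.
by rewrite other_endpoint //= otherK.
Qed.

Lemma tip_last_edge x es e : walk x (rcons es e) ->
  tip x (rcons es e) \in endpoints e.
Proof.
rewrite -cats1 walk_cat tip_cat /= andbT => /andP[_].
exact: other_endpoint.
Qed.

(** Only edges are kept from repeating, not vertices, so that paths and cycles are covered by one
    notion. *)
Definition trail H x es := [&& walk x es, uniq es & all (fun e => e \in H) es].

Lemma trail_rev H x es : trail H x es -> trail H (tip x es) (rev es).
Proof.
by case/and3P=> /walk_rev[w _] un al; rewrite /trail w rev_uniq un all_rev.
Qed.

Definition at_most_two H := forall u,
  (#|[set e in H | u \in endpoints e]| <= 2)%N.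

Lemma at_most_twoP H u e1 e2 e3 : at_most_two H ->
  e1 \in H -> e2 \in H -> e3 \in H ->
  u \in endpoints e1 -> u \in endpoints e2 -> u \in endpoints e3 ->
  e1 != e2 -> e3 \in [:: e1; e2].
Proof.
move=> dH h1 h2 h3 u1 u2 u3 ne; apply: contraTT (dH u) => e3N.
have un : uniq [:: e3; e1; e2] by rewrite /= e3N inE ne.
rewrite -ltnNge cardE.
apply: (@uniq_leq_size _ [:: e3; e1; e2]) => // e; rewrite mem_enum !inE.
by case/or3P => /eqP->; rewrite ?h1 ?h2 ?h3 ?u1 ?u2 ?u3.
Qed.

(** A trail that enters a vertex of degree at most two by one edge has only one edge to leave by.
    Hence the start and the first edge determine a trail up to its length. *)
Lemma trail_det H x e es es' : at_most_two H ->
  trail H x (e :: es) -> trail H x (e :: es') -> (size es <= size es')%N ->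
  exists t, es' = es ++ t.
Proof.
move=> dH; elim: es x e es' => [|f es IHes] x e es'; first by exists es'.
case: es' => [//|g es'] t1 t2; rewrite /= ltnS => les.
have fg : f = g.
  case/and3P: t1 => /= /and3P[xe of_ _] /andP[eN1 _] /and3P[He Hf _].
  case/and3P: t2 => /= /and3P[_ og _] /andP[eN2 _] /and3P[_ Hg _].
  move: eN1 eN2; rewrite !inE !negb_or => /andP[ef _] /andP[eg _].
  have := at_most_twoP dH He Hf Hg (other_endpoint xe) of_ og ef.
  by rewrite !inE eq_sym (negPf eg) /= => /eqP.
rewrite -{g}fg in t2 *.
have tl s : trail H x (e :: s) -> trail H (other x e) s.
  by case/and3P=> /= /andP[_ w] /andP[_ un] /andP[_ al]; apply/and3P.
have [t ->] := IHes _ _ _ (tl _ t1) (tl _ t2) les.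
by exists t.
Qed.

(** At an inner vertex the edge [f] has a neighbour in the sequence: its predecessor if [u] is where
    [f] is entered, its successor if [u] is where it is left. *)
Lemma trail_interior x es f u : walk x es -> uniq es -> f \in es ->
  u \in endpoints f -> u != x -> u != tip x es ->
  exists g, [/\ g \in es, g != f & u \in endpoints g].
Proof.
move=> w un fes; case/splitPr: fes w un => s1 s2.
rewrite walk_cat cat_uniq /= => /and3P[w1 zf w2] /and4P[_ dis fN _] uf ux ut.
move: uf; rewrite (endpointE u zf) => /orP[] /eqP uE.
  case/lastP: s1 => [|s1 g] in w1 dis uE zf w2 ut *.
    by rewrite uE eqxx in ux.
  exists g; rewrite uE tip_last_edge // mem_cat mem_rcons !inE eqxx /=.
  split=> //; apply: contraNneq dis => <-.
  by rewrite mem_rcons inE eqxx.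
case: s2 => [|g s2] in w2 dis fN ut *.
  by move: ut; rewrite uE tip_cat eqxx.
exists g; rewrite mem_cat !inE eqxx !orbT; move: w2 fN => /= /andP[ug _].
by rewrite inE negb_or eq_sym uE ug => /andP[].
Qed.

(** The two consecutive edges of the trail at an inner vertex exhaust its degree in [H]. *)
Lemma trail_saturated H x es f g u : at_most_two H -> trail H x es ->
  f \in es -> u \in endpoints f -> u != x -> u != tip x es ->
  g \in H -> u \in endpoints g -> g \in es.
Proof.
move=> dH /and3P[w un /allP al] fes uf ux ut Hg ug.
have [h [hes hf uh]] := trail_interior w un fes uf ux ut.
have := at_most_twoP dH (al _ hes) (al _ fes) Hg uh uf ug hf.
by rewrite !inE => /orP[] /eqP->.
Qed.

Lemma walk_endpoints x es e : walk x es -> e \in es ->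
  {subset endpoints e <= x :: scanl (@other G) x es}.
Proof.
elim: es x => //= f es IHes x /andP[xf w]; rewrite inE => /orP[/eqP->|ees] u.
  by rewrite (endpointE u xf) !inE => /orP[] ->; rewrite ?orbT.
by move=> /(IHes _ w ees); rewrite !inE => ->; rewrite orbT.
Qed.

Lemma spath_uniq x es : spath x es -> uniq es.
Proof.
case/and3P=> _; elim: es x => //= e es IHes x /andP[xe w] /andP[xN un].
rewrite (IHes _ w) // andbT; apply: contra xN => ees.
exact: (walk_endpoints w ees).
Qed.

Lemma subpath_trail H S : S \in subpaths H -> exists x es,
  [/\ trail H x es, es != [::], (size es <= #|G|)%N & S = [set e in es]].
Proof.
rewrite inE => /andP[SH /asboolP[x [es [sp SE]]]]; exists x, es.
have un := spath_uniq sp; case/and3P: sp => ne w unv; split=> //.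
  rewrite /trail w un; apply/allP => e ees /=; apply: (subsetP SH).
  by rewrite SE inE.
have: (size (x :: scanl (@other G) x es) <= #|G|)%N.
  by rewrite -(card_uniqP unv) max_card.
by rewrite /= size_scanl => /ltnW.
Qed.

Lemma subcycle_trail H S : S \in subcycles H -> exists x es,
  [/\ trail H x es, es != [::], (size es <= #|G|)%N & S = [set e in es]].
Proof.
rewrite inE => /andP[SH /asboolP[x [es [sp SE]]]]; exists x, es.
case/and5P: sp => ne w un unv _; split=> //.
  rewrite /trail w un; apply/allP => e ees /=; apply: (subsetP SH).
  by rewrite SE inE.
by rewrite -(size_scanl (@other G) x es) -(card_uniqP unv) max_card.
Qed.

(** * Counting sub-paths, cycles and pairs of sub-paths *)

Definition flags H : {set G * edge G} :=
  [set p | (p.2 \in H) && (p.1 \in endpoints p.2)].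

Lemma card_flags H : at_most_two H -> (#|flags H| <= #|G| * 2)%N.
Proof.
move=> dH; rewrite -sum_nat_const.
have -> : #|flags H| = (\sum_u #|[set e in H | u \in endpoints e]|)%N.
  under eq_bigr do rewrite -sum1_card.
  rewrite pair_big_dep /= -sum1_card; apply: eq_bigl => -[u e].
  by rewrite !inE.
by apply: leq_sum => u _; apply: dH.
Qed.

Lemma card_at_most_two H : at_most_two H -> (#|H| <= #|G| * 2)%N.
Proof.
move=> dH; apply: leq_trans (card_flags dH).
apply: (@leq_card_rel _ _ _ _ (fun e p => e = p.2)) => [e He|e e' p -> //].
have /existsP[u /existsP[v /andP[uv /eqP eE]]] := valP e.
by exists (u, e); rewrite // inE He /endpoints eE !inE eqxx.
Qed.

(** The code of a path or cycle is its start, its first edge and the number of remaining edges: at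
    most 2n flags times n lengths, where n is the number of vertices. *)
Lemma card_subpaths_cycles H : at_most_two H ->
  (#|subpaths H :|: subcycles H| <= 2 * #|G| ^ 2)%N.
Proof.
move=> dH; pose R S (p : G * edge G * 'I_#|G|) := exists es,
  [/\ trail H p.1.1 (p.1.2 :: es), size es = p.2 & S = [set e in p.1.2 :: es]].
apply: (@leq_trans #|setX (flags H) [set: 'I_#|G|]|).
  apply: (@leq_card_rel _ _ _ _ R) => [S|S S' [[x e] l]].
    have {}tr : S \in subpaths H :|: subcycles H -> exists x es,
        [/\ trail H x es, es != [::], (size es <= #|G|)%N & S = [set e in es]].
      by rewrite inE => /orP[/subpath_trail|/subcycle_trail].
    move=> /tr[x [[|e es] [tr' // _ sz SE]]].
    (* The first edge is not counted in the length, which is therefore strictly below [#|G|]. *)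
    exists (x, e, Ordinal sz); last by exists es.
    case/and3P: tr' => /= /andP[xe _] _ /andP[He _]; by rewrite !inE /= xe He.
  move=> [es [t sz ->]] [es' [t' sz' ->]] /=.
  have [t0 es'E] := trail_det dH t t' (eq_leq (etrans sz (esym sz'))).
  have := congr1 size es'E; rewrite size_cat sz sz' => /eqP.
  rewrite -{1}[val _]addn0 eqn_add2l eq_sym size_eq0 es'E => /eqP->.
  by rewrite cats0.
rewrite cardsX cardsT card_ord expnS expn1 mulnA leq_mul2r mulnC.
by rewrite card_flags ?orbT.
Qed.

Lemma ends_trail H x es u : es != [::] -> trail H x es ->
  u \in ends [set e in es] -> u \in [:: x; tip x es].
Proof.
move=> ne /and3P[w un al]; rewrite inE => /cards1P[f fE].
have: f \in [set f] by rewrite inE.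
rewrite -fE !inE => /andP[fes uf].
apply: contraT; rewrite negb_or => /andP[ux ut].
have [g [ges gf ug]] := trail_interior w un fes uf ux ut.
have: g \in [set f] by rewrite -fE !inE ges.
by rewrite inE (negPf gf).
Qed.

(** The trail is reversed if necessary, so that it finishes at the end of [H]. *)
Lemma one_end_trail H S : S \in one_end_paths H -> exists x es,
  [/\ trail H x es, es != [::], tip x es \in ends H & S = [set e in es]].
Proof.
rewrite inE => /andP[/subpath_trail[x [es [tr ne _ SE]]] /cards1P[u uE]].
have: u \in [set u] by rewrite inE.
rewrite -uE !inE -/(ends _) => /andP[uS uH].
have := ends_trail ne tr; move=> /(_ u); rewrite -SE inE uS => /(_ isT).
rewrite !inE => /orP[] /eqP uE'; last first.
  by exists x, es; split=> //; rewrite inE -uE'.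
exists (tip x es), (rev es); split; first exact: trail_rev.
- by rewrite -size_eq0 size_rev size_eq0.
- by have /and3P[/walk_rev[_ ->] _ _] := tr; rewrite inE -uE'.
- by rewrite SE; apply/setP => e; rewrite !inE mem_rev.
Qed.

(** Here the code is a flag without a length, because a trail stops for good when it reaches an end
    of [H]. *)
Lemma card_one_end_paths H : at_most_two H -> (#|one_end_paths H| <= #|G| * 2)%N.
Proof.
move=> dH; apply: leq_trans (card_flags dH).
pose R S (p : G * edge G) := exists es, [/\ trail H p.1 (p.2 :: es),
  tip p.1 (p.2 :: es) \in ends H & S = [set e in p.2 :: es]].
apply: (@leq_card_rel _ _ _ _ R) => [S|S S' [x e]].
  move=> /one_end_trail[x [[|e es] [tr // _ tH SE]]].
  exists (x, e); last by exists es.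
  by case/and3P: tr => /= /andP[xe _] _ /andP[He _]; rewrite !inE /= xe He.
(* If the longer trail had a further edge [g], then [g] and the last edge of the shorter one would
   be two edges of [H] at a vertex of degree one. *)
have stop es es' : trail H x (e :: es) -> trail H x (e :: es') ->
    tip x (e :: es) \in ends H -> (size es <= size es')%N -> es = es'.
  move=> t t' tH /(trail_det dH t t')[[|g t0] es'E].
    by rewrite es'E cats0.
  move: t'; rewrite es'E -cat_cons /trail walk_cat cat_uniq all_cat.
  case/and3P=> /= /and3P[_ tg _] /and3P[_ gN _].
  case/andP=> /= /andP[He al] /andP[Hg _].
  have le : last e es \in H by case/and3P: t => _ _ /allP; apply; rewrite mem_last.
  have te : tip x (e :: es) \in endpoints (last e es).
    by case/and3P: t => w _ _; rewrite lastI in w *; apply: tip_last_edge.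
  move: tH; rewrite inE => /cards1P[f fE].
  have gf : g \in [set f] by rewrite -fE inE Hg.
  have le' : last e es \in [set f] by rewrite -fE inE le.
  move: gN; rewrite negb_or => /andP[/negP gN _]; case: gN.
  by rewrite (set1P gf) -(set1P le'); apply: mem_last.
move=> [es [t tH ->]] [es' [t' tH' ->]] /=.
have [/stop-> //|/ltnW/stop-> //] := leqP (size es) (size es').
Qed.

(** The number of pairs among at most 2n sub-paths is at most n(2n-1). *)
Lemma card_path_pairs H : at_most_two H -> (#|path_pairs H| <= 2 * #|G| ^ 2)%N.
Proof.
move=> /card_one_end_paths le.
have -> : #|path_pairs H| = 'C(#|one_end_paths H|, 2).
  by rewrite -cards_draws; apply: eq_card => P; rewrite !inE andbC.
apply: leq_trans (leq_bin2l 2 le) _.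
by rewrite bin2; nia.
Qed.

End Trails.

(** * Probabilities that vanish or are bounded below *)

Section Gap.
Implicit Types (d p q : rat).

(** A lower bound that is valid for the transitions that can occur. The disjunction passes through
    sums, products and uniform draws; the zero case is discarded only at the end, where the inverse
    way has positive probability. *)
Definition gap d p := p = 0 \/ d <= p.

Lemma gap_le d d' p : d' <= d -> gap d p -> gap d' p.
Proof. by move=> le [->|le']; [left | right; apply: le_trans le']. Qed.

Lemma gap_mul d d' p q : 0 <= d -> 0 <= d' ->
  gap d p -> gap d' q -> gap (d * d') (p * q).
Proof.
move=> d0 d0' [->|dp]; first by left; rewrite mul0r.
case=> [->|dq]; first by left; rewrite mulr0.
by right; apply: ler_pM.
Qed.

Lemma gap_add d p q : 0 <= d -> gap d p -> gap d q -> gap d (p + q).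
Proof.
move=> d0 [->|dp]; first by rewrite add0r.
by case=> [->|dq]; rewrite ?addr0; right; lra.
Qed.

Lemma gap_sum d (I : finType) (A : {pred I}) (F : I -> rat) : 0 <= d ->
  (forall i, i \in A -> gap d (F i)) -> gap d (\sum_(i in A) F i).
Proof.
move=> d0 gF; apply: (big_ind (gap d)); last exact: gF.
  by left.
by move=> p q; apply: gap_add.
Qed.

Lemma gap_dirac (T : finType) (x y : T) : gap 1 (dirac x y).
Proof. by rewrite /dirac; case: eqP => _; [right | left]. Qed.

(** One possible outcome among at most [m] retains [d / m]. An empty draw is a [dirac], with gap 1,
    and the bounds on [d] and [m] give [d / m <= 1]. *)
Lemma gap_unif d (m : nat) (T I : finType) (x y : T) (A : {set I}) F :
  0 <= d <= 1 -> (0 < m)%N -> (#|A| <= m)%N ->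
  (forall i, i \in A -> gap d (F i y)) -> gap (d / m%:R) (unif x A F y).
Proof.
move=> /andP[d0 d1] m0 Am gF; rewrite /unif; case: eqP => [_|/eqP A0].
  apply: gap_le (gap_dirac x y).
  by rewrite ler_pdivrMr ?ltr0n // mul1r (le_trans d1) // ler1n.
rewrite -card_gt0 in A0.
apply: gap_mul; rewrite ?invr_ge0 ?ler0n //; first exact: gap_sum.
by right; rewrite lef_pV2 ?posrE ?ltr0n // ler_nat.
Qed.

End Gap.

(** * Functions of total mass one, for the upper bound 1 on the numerator *)

Section Distributions.
Variable T : finType.
Implicit Types (p q : T -> rat) (x y : T).

Definition is_distr p := (forall y, 0 <= p y) /\ \sum_y p y = 1.

Lemma distr_le1 p y : is_distr p -> p y <= 1.
Proof.
move=> [p0 <-]; rewrite (bigD1 y) //= lerDl; apply: sumr_ge0 => z _; exact: p0.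
Qed.

Lemma distr_dirac x : is_distr (dirac x).
Proof.
split=> [y|]; first by rewrite /dirac ler0n.
rewrite (bigD1 x) //= big1 ?addr0 => [|y yx]; first by rewrite /dirac eqxx.
by rewrite /dirac eq_sym (negPf yx).
Qed.

Lemma distr_unif (I : finType) x (A : {set I}) (F : I -> T -> rat) :
  (forall i, i \in A -> is_distr (F i)) -> is_distr (unif x A F).
Proof.
move=> dF; have [->|A0] := eqVneq A set0.
  have [d0 d1] := distr_dirac x.
  have E y : unif x set0 F y = dirac x y by rewrite /unif eqxx.
  split=> [y|]; first by rewrite E.
  by under eq_bigr do rewrite E.
split=> [y|]; rewrite /unif.
  rewrite (negPf A0) divr_ge0 ?ler0n //; apply: sumr_ge0 => i Ai.
  by have [] := dF i Ai.
under eq_bigr do rewrite (negPf A0).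
rewrite -mulr_suml exchange_big /=.
under eq_bigr => i Ai do rewrite (proj2 (dF i Ai)).
rewrite sumr_const divff // pnatr_eq0 -lt0n card_gt0 //.
Qed.

Lemma distr_mix2 p q :
  is_distr p -> is_distr q -> is_distr (fun y => 2^-1 * p y + 2^-1 * q y).
Proof.
move=> [p0 p1] [q0 q1]; split=> [y|].
  by have := p0 y; have := q0 y; lra.
by rewrite big_split /= -!mulr_sumr p1 q1; lra.
Qed.

Lemma distr_mix3 p q r : is_distr p -> is_distr q -> is_distr r ->
  is_distr (fun y => 3^-1 * p y + 3^-1 * q y + 3^-1 * r y).
Proof.
move=> [p0 p1] [q0 q1] [r0 r1]; split=> [y|].
  by have := p0 y; have := q0 y; have := r0 y; lra.
by rewrite !big_split /= -!mulr_sumr p1 q1 r1; lra.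
Qed.

Lemma distr_bind p (F : T -> T -> rat) : is_distr p ->
  (forall x, is_distr (F x)) -> is_distr (fun y => \sum_x p x * F x y).
Proof.
move=> [p0 p1] dF; split=> [y|].
  by apply: sumr_ge0 => x _; rewrite mulr_ge0 ?p0 // (proj1 (dF x)).
rewrite exchange_big /= -p1; apply: eq_bigr => x _.
by rewrite -mulr_sumr (proj2 (dF x)) mulr1.
Qed.

End Distributions.

(** * Deficiencies after flipping two colours *)

Section Swapped.
Variables (G : sgraph) (k : nat) (C : color_map G k) (c c' : 'I_k).
Hypothesis properC : edge_coloring C.
Implicit Types (K : color_map G k) (a b d : 'I_k) (u v x : G).
Implicit Types (e f : edge G) (es : seq (edge G)) (S : {set edge G}).

Local Notation H := (color_edges C c c').

Lemma edge_coloring_neq u e e' :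
  u \in endpoints e -> u \in endpoints e' -> e != e' -> C e != C e'.
Proof.
move=> ue ue' ne; have /forallP/(_ e)/forallP/(_ e')/implyP := properC.
apply; rewrite ne; apply/negP => /disjointFr /(_ ue).
by rewrite ue'.
Qed.

Lemma color_edges_at_most_two : at_most_two H.
Proof.
move=> u; have inj : {in [set e in H | u \in endpoints e] &, injective C}.
  move=> e e'; rewrite !inE => /andP[_ ue] /andP[_ ue'] /eqP CE.
  by apply: contraTeq CE => ne; apply: (edge_coloring_neq ue ue' ne).
rewrite -(card_in_imset inj); apply: leq_trans (_ : #|[set c; c']| <= 2)%N.
  apply/subset_leq_card/subsetP => _ /imsetP[e + ->].
  by rewrite !inE => /andP[].
by rewrite cards2; case: eqP.
Qed.

(* The intermediate maps K1 and K2 of a way are of this kind with respect to C1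
   and C2 respectively, as are the maps met while eliminating deficiencies. *)
Definition swapped K := forall e,
  if e \in H then K e \in [:: c; c'] else K e == C e.

Lemma swapped_refl : swapped C.
Proof. by move=> e; case: ifP => //; rewrite !inE. Qed.

Lemma swapped_in K e : swapped K -> (K e \in [:: c; c']) = (e \in H).
Proof.
move=> /(_ e); case: ifP => [_ -> //|eN /eqP->].
by rewrite -eN !inE.
Qed.

Lemma swapped_flip K S : swapped K -> swapped (flip K c c' S).
Proof.
move=> sw e; have := swapped_in e sw; move: (sw e); rewrite ffunE.
case: ifP => _ KE Kin; case: ifP => // _.
  by rewrite !inE; case: tpermP => [_|_|/eqP/negPf Kc /eqP/negPf Kc'];
    rewrite ?eqxx ?orbT //; rewrite !inE Kc Kc' in KE.
move: Kin; rewrite !inE => /negbT/norP[ne ne'].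
by rewrite tpermD // eq_sym.
Qed.

Lemma color_edges_swapped K : swapped K -> color_edges K c c' = H.
Proof. by move=> sw; apply/setP => e; rewrite -(swapped_in _ sw) !inE. Qed.

Lemma card_edges_at_swapped K v d : swapped K -> d != c -> d != c' ->
  (#|edges_at K v d| <= 1)%N.
Proof.
move=> sw dc dc'; apply/card_le1_eqP => e e'.
have off f : f \in edges_at K v d -> v \in endpoints f /\ C f = d.
  rewrite inE => /andP[vf /eqP Kf]; split=> //.
  have := sw f; case: ifP => [_|_ /eqP<- //].
  by rewrite Kf !inE (negPf dc) (negPf dc').
move=> /off[ve Ce] /off[ve' Ce']; apply/eqP.
have := @edge_coloring_neq v e' e ve' ve; rewrite Ce Ce' eqxx.
by case: eqVneq => // _ /(_ isT).
Qed.

Lemma card_edges_at_pair_swapped K v : swapped K ->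
  (#|edges_at K v c :|: edges_at K v c'| <= 2)%N.
Proof.
move=> sw; apply: leq_trans (color_edges_at_most_two v).
apply/subset_leq_card/subsetP => e eK.
suff /andP[He ve] : (K e \in [:: c; c']) && (v \in endpoints e).
  by rewrite inE -(swapped_in e sw) He.
by move: eK; rewrite !inE => /orP[] /andP[-> ->]; rewrite ?orbT.
Qed.

(* Replaces [deficients] as a measure of progress: no missing colour has to be
   tracked. *)
Definition clashes K : {set G} :=
  [set u | [exists e1, exists e2, [&& e1 \in H, e2 \in H, e1 != e2,
     u \in endpoints e1, u \in endpoints e2 & K e1 == K e2]]].

Lemma clashesP K u : reflect (exists e1 e2, [/\ e1 \in H, e2 \in H, e1 != e2 &
    [/\ u \in endpoints e1, u \in endpoints e2 & K e1 = K e2]])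
  (u \in clashes K).
Proof.
rewrite inE; apply: (iffP existsP) => [[e1 /existsP[e2]]|[e1 [e2]]].
  by case/and5P => h1 h2 ne u1 /andP[u2 /eqP KE]; exists e1, e2.
move=> [h1 h2 ne [u1 u2 KE]]; exists e1; apply/existsP; exists e2.
by rewrite h1 h2 ne u1 u2 KE eqxx.
Qed.

(** Colours other than [c] and [c'] are as in the proper colouring [C], so they cannot be repeated
    at a vertex. *)
Lemma deficiency_swapped K v a b : swapped K -> deficiency K v a b ->
  exists e1 e2, [/\ edges_at K v a = [set e1; e2], e1 != e2,
    e1 \in H, e2 \in H & a \in [:: c; c']].
Proof.
move=> sw /and3P[/eqP two _ _].
have ain : a \in [:: c; c'].
  apply/negPn/negP; rewrite !inE => /norP[ac ac'].
  by have := card_edges_at_swapped v sw ac ac'; rewrite two.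
have /cards2P[e1 [e2 [ne aE]]] := introT eqP two.
exists e1, e2; split=> //; rewrite -(swapped_in _ sw).
  by have := set21 e1 e2; rewrite -aE inE => /andP[_ /eqP->].
by have := set22 e1 e2; rewrite -aE inE => /andP[_ /eqP->].
Qed.

Lemma deficients_sub_clashes K : swapped K -> deficients K \subset clashes K.
Proof.
move=> sw; apply/subsetP => v; rewrite inE => /existsP[a /existsP[b def]].
have [e1 [e2 [aE ne h1 h2 _]]] := deficiency_swapped sw def.
have at_v e : e \in [set e1; e2] -> v \in endpoints e /\ K e = a.
  by rewrite -aE inE => /andP[ve /eqP].
have [v1 K1] := at_v _ (set21 e1 e2); have [v2 K2] := at_v _ (set22 e1 e2).
by apply/clashesP; exists e1, e2; split=> //; rewrite K1 K2.
Qed.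

(** * Vertices at which a flipped edge set meets the rest of the two-coloured subgraph *)

Definition boundary S : {set G} :=
  [set u | [exists e1, exists e2, [&& e1 \in H :&: S, e2 \in H :\: S,
     u \in endpoints e1 & u \in endpoints e2]]].

Lemma boundaryP S u : reflect (exists e1 e2, [/\ e1 \in H, e1 \in S, e2 \in H,
    e2 \notin S & u \in endpoints e1 /\ u \in endpoints e2]) (u \in boundary S).
Proof.
rewrite inE; apply: (iffP existsP) => [[e1 /existsP[e2]]|[e1 [e2]]].
  case/and4P => /setIP[h1 s1] /setDP[h2 s2] u1 u2; by exists e1, e2.
move=> [h1 s1 h2 s2 [u1 u2]]; exists e1; apply/existsP; exists e2.
by rewrite inE h1 s1 inE s2 h2 u1.
Qed.

(** Two edges both inside or both outside [S] keep distinct colours, since a transposition is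
    injective. *)
Lemma clashes_flip S : clashes (flip C c c' S) \subset boundary S.
Proof.
apply/subsetP => u /clashesP[e1 [e2 [h1 h2 ne [u1 u2]]]]; rewrite !ffunE.
have := edge_coloring_neq u1 u2 ne.
case: ifP => s1; case: ifP => s2 Cne CE.
- by rewrite (perm_inj CE) eqxx in Cne.
- by apply/boundaryP; exists e1, e2; rewrite s2.
- by apply/boundaryP; exists e2, e1; rewrite s1.
- by rewrite CE eqxx in Cne.
Qed.

Lemma boundary_trail x es : trail H x es ->
  boundary [set e in es] \subset [set x; tip x es].
Proof.
move=> tr; apply/subsetP => u /boundaryP[e1 [e2 [h1 s1 h2 s2 [u1 u2]]]].
rewrite !inE in s1 s2 *; apply: contraNT s2 => /norP[ux ut].
exact: (trail_saturated color_edges_at_most_two tr s1 u1 ux ut).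
Qed.

Lemma card_boundary_trail x es : trail H x es ->
  (#|boundary [set e in es]| <= 2)%N.
Proof.
move=> /boundary_trail/subset_leq_card/leq_trans; apply.
by rewrite cards2; case: eqP.
Qed.

(** Only the start of the trail can be a boundary vertex: its tip has a single edge in [H], which
    cannot be both inside and outside [S]. *)
Lemma card_boundary_one_end S : S \in one_end_paths H ->
  (#|boundary S| <= 1)%N.
Proof.
move=> /one_end_trail[x [es [tr _ tH ->]]].
suff: boundary [set e in es] \subset [set x].
  by move=> /subset_leq_card/leq_trans; apply; rewrite cards1.
apply/subsetP => u bu; have := subsetP (boundary_trail tr) u bu.
rewrite !inE => /orP[//|/eqP ut]; move: bu => /boundaryP.
move=> [e1 [e2 [h1 s1 h2 s2 [u1 u2]]]].
move: tH; rewrite -ut inE => /cards1P[f fE].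
have: e1 \in [set f] by rewrite -fE inE h1.
have: e2 \in [set f] by rewrite -fE inE h2.
by move=> /set1P E2 /set1P E1; rewrite E2 -E1 s1 in s2.
Qed.

(** The flipped edges form the symmetric difference, and two edges separated by it are separated by
    [S1] or by [S2]. *)
Lemma boundary_flipped (S1 S2 : {set edge G}) : S1 != S2 ->
  boundary (flipped_edges [set S1; S2]) \subset boundary S1 :|: boundary S2.
Proof.
move=> ne; have memF e : (e \in flipped_edges [set S1; S2]) =
    (e \in S1) (+) (e \in S2).
  rewrite inE -sum1_card.
  rewrite (eq_bigl (fun S => (S \in [set S1; S2]) && (e \in S))); last first.
    by move=> S; rewrite inE.
  by rewrite big_mkcondr /= big_setU1 ?inE // big_set1; do 2 case: (e \in _).
have sym S u : (exists e1 e2, [/\ e1 \in H, e2 \in H, (e1 \in S) != (e2 \in S),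
    u \in endpoints e1 & u \in endpoints e2]) -> u \in boundary S.
  move=> [e1 [e2 [h1 h2 + u1 u2]]].
  case s1: (e1 \in S); case s2: (e2 \in S) => // _; apply/boundaryP.
    by exists e1, e2; rewrite s2.
  by exists e2, e1; rewrite s1.
apply/subsetP => u /boundaryP[e1 [e2 [h1 s1 h2 s2 [u1 u2]]]].
rewrite inE; have [E1|N1] := eqVneq (e1 \in S1) (e2 \in S1); last first.
  by rewrite sym //; exists e1, e2.
rewrite (@sym S2) ?orbT //; exists e1, e2; split=> //.
by move: s1 s2; rewrite !memF E1; do 3 case: (_ \in _).
Qed.

Lemma card_boundary_pair P : P \in path_pairs H ->
  (#|boundary (flipped_edges P)| <= 2)%N.
Proof.
rewrite inE => /andP[/cards2P[S1 [S2 [ne ->]]] /subsetP sub].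
apply: leq_trans (subset_leq_card (boundary_flipped ne)) _.
apply: leq_trans (leq_card_setU _ _) _.
by rewrite (leq_add (card_boundary_one_end _) (card_boundary_one_end _)) ?sub ?inE ?eqxx ?orbT.
Qed.

End Swapped.

(** * Elimination of deficiencies *)

(** Each step changes the side of the bipartition and also, by alternation, the colour of the next
    edge; the parity of the two is invariant along the walk. *)
Lemma alternating_side (G : sgraph) (k : nat) (A : {set G})
    (K : color_map G k) (a b : 'I_k) x s1 f s2 :
  (forall u v, adj u v -> (u \in A) != (v \in A)) -> a != b ->
  walk x (s1 ++ f :: s2) -> alternating K a b (s1 ++ f :: s2) ->
  (tip x s1 \in A) (+) (K f == a) = (x \in A) (+) (K (head f s1) == a).
Proof.
move=> bip ab; elim: s1 x => [//|g s1 IHs] x /= /andP[xg w].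
case/andP => /= /andP[gab alab] pth.
have alt : alternating K a b (s1 ++ f :: s2).
  by rewrite /alternating alab (path_sorted pth).
rewrite (IHs _ w alt).
have [_ /bip xo _] := endpoints_other xg.
have hd : K (head f s1) \in [:: a; b] /\ K g != K (head f s1).
  by case: (s1) alab pth => [|h s] /= /andP[-> _] /andP[-> _].
have -> : (K (head f s1) == a) = ~~ (K g == a).
  case: hd gab; rewrite !inE => /orP[] /eqP-> ne /orP[] /eqP gE;
    by rewrite gE ?eqxx // in ne *; rewrite eq_sym (negPf ab).
by move: xo; case: (x \in A); case: (other x g \in A); case: (K g == a).
Qed.

Section Elimination.
Variables (G : sgraph) (k : nat) (C : color_map G k) (c c' : 'I_k).
Hypotheses (properC : edge_coloring C) (bipG : bipartite G).
Implicit Types (K : color_map G k) (a b : 'I_k) (u v x : G).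
Implicit Types (d e f : edge G) (es : seq (edge G)) (S : {set edge G}).

Local Notation H := (color_edges C c c').
Local Notation swapped := (swapped C c c').
Local Notation clashes := (clashes C c c').
Let two_H : at_most_two H := color_edges_at_most_two c c' properC.

(** A trail leaving [v] by one of its two [a]-edges never uses the other one, [d]. By parity it
    would traverse [d] starting from [v], after arriving at [v] by an edge not coloured [a]; but [d]
    and [e] already exhaust the degree of [v] in [H]. *)
Lemma alternating_no_return K a b v e d s : swapped K ->
  [:: a; b] =i [:: c; c'] -> a != b ->
  trail H v (e :: s) -> alternating K a b (e :: s) ->
  d \in H -> d != e -> v \in endpoints d -> K d = a -> K e = a ->
  d \notin e :: s.
Proof.
move=> sw abcc ab tr alt dH de vd Kd Ke; apply/negP => ds.
have [A bip] := bipG.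
have [s1 [s2 sE]] : exists s1 s2, e :: s = (e :: s1) ++ d :: s2.
  move: ds; rewrite inE (negPf de) /= => /splitPr[s1 s2].
  by exists s1, s2.
rewrite {s ds}sE in tr alt.
case/and3P: tr => w un al.
have := alternating_side bip ab w alt; rewrite /= Kd Ke eqxx => /addIb side.
move: w; rewrite walk_cat => /andP[w1 /= /andP[zd _]].
have vz : v = tip v (e :: s1).
  move: vd; rewrite (endpointE v zd) => /orP[/eqP//|/eqP vo].
  have [_ /bip + _] := endpoints_other zd.
  by rewrite -vo /= side eqxx.
case/lastP E: (e :: s1) => [//|s0 g]; rewrite E in w1 alt al vz.
have vg : v \in endpoints g by rewrite vz tip_last_edge.
have gH : g \in H by apply: (allP al); rewrite mem_cat mem_rcons mem_head.
have eH : e \in H.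
  by apply: (allP al); rewrite -E inE eqxx.
have ve : v \in endpoints e by move: w1; rewrite -E => /andP[].
have gd : K g != a.
  by case/andP: alt => _; rewrite cat_rcons => /cat_sorted2[_ /= /andP[+ _]]; rewrite Kd.
have := at_most_twoP two_H dH eH gH vd ve vg de.
by rewrite !inE => /orP[] /eqP gE; rewrite gE ?Kd ?Ke eqxx in gd.
Qed.

(** At [v] the edge [e] is recoloured and [d] is not, so the clash disappears. Elsewhere no clash
    arises, because the trail is maximal. *)
Lemma clashes_flip_trail K a b v e d S : swapped K ->
  [:: a; b] =i [:: c; c'] -> a != b ->
  e \in H -> v \in endpoints e -> K e = a ->
  d \in H -> d != e -> v \in endpoints d -> K d = a ->
  maxset (alt_trail K a b v e) S ->
  clashes (flip K a b S) \subset clashes K :\ v.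
Proof.
move=> sw abcc ab He ve Ke Hd de vd Kd /maxsetP[/asboolP].
move=> [[|e' s] [//= [e'E] w un alt SE] max]; rewrite {e'}e'E in w un alt SE.
have tr : trail H v (e :: s).
  apply/and3P; split=> //; apply/allP => f fs.
  by rewrite -(swapped_in f sw) -abcc; case/andP: alt => /allP/(_ f fs).
have dS : d \notin S.
  by rewrite SE inE (alternating_no_return sw abcc ab tr alt).
have eS : e \in S by rewrite SE inE mem_head.
(* A new clash needs differently coloured edges at [u], exactly one of them flipped. Then [u] is the
   tip, [e1] is the last edge, and [e2] would prolong the alternating trail. *)
have new_clash u e1 e2 : u != v -> e1 \in H -> e2 \in H -> u \in endpoints e1 ->
    u \in endpoints e2 -> K e1 != K e2 -> e1 \in S -> e2 \notin S -> False.
  move=> uv h1 h2 u1 u2 K12; rewrite SE ![_ \in [set _ in _]]inE => s1 s2.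
  have [ut|ut] := eqVneq u (tip v (e :: s)); last first.
    by rewrite (trail_saturated two_H tr s1 u1 uv ut h2 u2) in s2.
  have lH : last e s \in H by case/and3P: tr => _ _ /allP; apply; apply: mem_last.
  have ul : u \in endpoints (last e s).
    rewrite ut; move: (w : walk v (e :: s)); rewrite lastI.
    exact: tip_last_edge.
  have le1 : last e s = e1.
    apply/eqP; apply: contraNT s2 => ne.
    have := at_most_twoP two_H lH h1 h2 ul u1 u2 ne.
    by case/predU1P=> [->|/predU1P[->|//]]; rewrite ?mem_last.
  have alt2 : alt_trail K a b v e [set f in rcons (e :: s) e2].
    apply/asboolP; exists (rcons (e :: s) e2); split=> //.
    - by move: u2; rewrite ut -cats1 walk_cat [walk _ _]w /= andbT.
    - by rewrite rcons_uniq s2.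
    - case/andP: alt => al so; apply/andP; split.
        by rewrite all_rcons al abcc (swapped_in e2 sw) h2.
      by rewrite /= rcons_path [path _ _ _]so le1.
  have sub : S \subset [set f in rcons (e :: s) e2].
    rewrite SE; apply/subsetP => f; rewrite inE => fs.
    by rewrite inE mem_rcons inE fs orbT.
  have := max _ alt2 sub => /setP/(_ e2).
  by rewrite SE ![_ \in [set _ in _]]inE (negPf s2) mem_rcons mem_head.
apply/subsetP => u /clashesP[e1 [e2 [h1 h2 ne [u1 u2]]]]; rewrite !ffunE => KE.
have Sab f : f \in S -> K f = a \/ K f = b.
  rewrite SE inE => fs; case/andP: alt => /allP/(_ f fs) + _.
  by rewrite !inE => /orP[] /eqP; [left | right].
have uv : u != v.
  apply: contraTneq ne => uv; rewrite uv in u1 u2.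
  have := at_most_twoP two_H He Hd h1 ve vd u1; rewrite eq_sym de => /(_ isT).
  have := at_most_twoP two_H He Hd h2 ve vd u2; rewrite eq_sym de => /(_ isT).
  rewrite !inE => /orP[] /eqP E2 /orP[] /eqP E1; rewrite E1 E2 ?eqxx //;
    by move: KE; rewrite E1 E2 eS (negPf dS) Kd Ke tpermL => KE; rewrite KE eqxx in ab.
apply/setD1P; split=> //.
suff K12 : K e1 = K e2 by apply/clashesP; exists e1, e2.
apply/eqP/negPn/negP => Kne; move: KE.
case s1: (e1 \in S); case s2: (e2 \in S) => KE.
- by rewrite (perm_inj KE) eqxx in Kne.
- exact: (new_clash u e1 e2 uv h1 h2 u1 u2 Kne s1 (negbT s2)).
- by rewrite eq_sym in Kne; apply: (new_clash u e2 e1 uv h2 h1 u2 u1 Kne s2 (negbT s1)).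
- by rewrite KE eqxx in Kne.
Qed.

End Elimination.

(** * Possible outcomes of a draw, and the repeated elimination *)

Lemma dirac_neq0 (T : finType) (x y : T) : dirac x y != 0 -> x = y.
Proof. by rewrite /dirac; case: (x =P y) => // _; rewrite mulr0n eqxx. Qed.

Lemma unif_neq0 (T I : finType) (x y : T) (A : {set I}) F : unif x A F y != 0 ->
  if A == set0 then x = y else exists2 i, i \in A & F i y != 0.
Proof.
rewrite /unif; case: ifP => _; first exact: dirac_neq0.
move=> ne; suff /existsP[i /andP[Ai Fi]] : [exists i, (i \in A) && (F i y != 0)].
  by exists i.
apply: contraNT ne => /existsPn none; rewrite big1 ?mul0r // => i Ai.
by have := none i; rewrite Ai negbK => /eqP.
Qed.

Lemma sum_dirac (T : finType) (x : T) (F : T -> rat) :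
  \sum_y dirac x y * F y = F x.
Proof.
rewrite (bigD1 x) //= big1 ?addr0 /dirac ?eqxx ?mul1r // => y yx.
by rewrite eq_sym (negPf yx) mul0r.
Qed.

(** A deficient vertex has only one repeated colour, and it is carried by exactly two edges. *)
Lemma card_dup_edges (G : sgraph) (k : nat) (K : color_map G k) v :
  (#|dup_edges K v| <= 2)%N.
Proof.
have [->|[e]] := set_0Vmem (dup_edges K v); first by rewrite cards0.
rewrite inE => /existsP[a /existsP[b /andP[/and3P[/eqP aE oth _] _]]].
rewrite -aE; apply/subset_leq_card/subsetP => f.
rewrite inE => /existsP[a' /existsP[b' /andP[/and3P[/eqP a'E _ _]]]].
suff -> : a' = a by [].
by apply/eqP; apply: contraTT (forallP oth a') => ne; rewrite ne a'E.
Qed.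

Section Eliminate.
Variables (G : sgraph) (k : nat) (C : color_map G k) (c c' : 'I_k).
Hypotheses (properC : edge_coloring C) (cc' : c != c') (bipG : bipartite G).
Variables (pickV : color_map G k -> {set G} -> G)
          (pickP : color_map G k -> {set {set edge G}} -> {set edge G}).
Hypotheses (pickVP : forall K D, D != set0 -> pickV K D \in D)
           (pickPP : forall K F, F != set0 -> pickP K F \in F).
Implicit Types (K : color_map G k) (a b : 'I_k) (u v x : G).
Implicit Types (d e f : edge G) (S : {set edge G}) (pal : seq 'I_k).

Local Notation H := (color_edges C c c').
Local Notation swapped := (swapped C c c').
Local Notation clashes := (clashes C c c').
Let two_H : at_most_two H := color_edges_at_most_two c c' properC.

Lemma deficiency_irr K v a : ~~ deficiency K v a a.
Proof. by apply/and3P => -[/eqP + _ /eqP aE]; rewrite aE cards0. Qed.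

(** The two [a]-edges exhaust the degree of [v] in [H], so the other one of [c] and [c'] is missing
    at [v] whatever [b] is. *)
Lemma deficiency_change K v a b b' : swapped K -> deficiency K v a b ->
  b' \in [:: c; c'] -> b' != a -> deficiency K v a b'.
Proof.
move=> sw def b'in b'a; have := def => /and3P[aE oth _].
apply/and3P; split=> //.
have [e1 [e2 [E ne h1 h2 ain]]] := deficiency_swapped properC sw def.
apply: contraTT isT => /set0Pn[f]; rewrite inE => /andP[vf /eqP Kf].
have at_v e : e \in [set e1; e2] -> v \in endpoints e /\ K e = a.
  by rewrite -E inE => /andP[ve /eqP].
have [v1 K1] := at_v _ (set21 e1 e2); have [v2 K2] := at_v _ (set22 e1 e2).
have hf : f \in H by rewrite -(swapped_in f sw) Kf.
have := at_most_twoP two_H h1 h2 hf v1 v2 vf ne; rewrite !inE.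
by case/orP => /eqP fE; rewrite -Kf fE ?K1 ?K2 eqxx in b'a.
Qed.

(** Every possible repair is a flip in the colours [c] and [c'] that removes the selected vertex
    from the clashes and adds none. *)
Lemma elim_step_neq0 pal K K' : swapped K -> deficients K != set0 ->
  elim_step pickV pickP [:: c, c' & pal] K K' != 0 ->
  swapped K' /\ (#|clashes K'| < #|clashes K|)%N.
Proof.
move=> sw D0; rewrite /elim_step (negPf D0).
set v := pickV K (deficients K).
have vD : v \in deficients K by apply: pickVP.
move=> /unif_neq0; case: ifP => [/eqP dup0|_ [e]].
  move: vD; rewrite inE => /existsP[a /existsP[b def]].
  have [e1 [e2 [E _ _ _ _]]] := deficiency_swapped properC sw def.
  have: e1 \in dup_edges K v.
    rewrite inE; apply/existsP; exists a; apply/existsP; exists b.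
    by rewrite def E set21.
  by rewrite dup0 inE.
rewrite inE => /existsP[a /existsP[b0 /andP[def ea]]].
have Ke : K e = a by move: ea; rewrite inE => /andP[_ /eqP].
have [e1 [e2 [E ne h1 h2 ain]]] := deficiency_swapped properC sw def.
rewrite Ke; set b := head _ _ => /dirac_neq0 <-.
(* The palette starts with [c] and [c'], so the first missing colour is the one of them that differs
   from [a]. *)
have [bcc ab] : [:: a; b] =i [:: c; c'] /\ a != b.
  have chg := deficiency_change sw def.
  move: (deficiency_irr K v a) chg ain; rewrite /b !inE /= => irr chg.
  case/orP => /eqP aE; rewrite aE in irr chg *.
    rewrite (negPf irr) (chg c') /= ?inE ?eqxx ?orbT // eq_sym //.
  rewrite (chg c) /= ?inE ?eqxx // eq_sym; split=> // x.
  by rewrite !inE orbC.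
have flipE S : flip K a b S = flip K c c' S.
  have: a \in [:: c; c'] by rewrite ain.
  have: b \in [:: c; c'] by rewrite -bcc !inE eqxx orbT.
  rewrite !inE => /orP[] /eqP bE /orP[] /eqP aE; rewrite bE aE ?eqxx // in ab *.
  by rewrite /flip tpermC.
set S := pickP K _.
have maxS : maxset (alt_trail K a b v e) S.
  suff: S \in max_alt_trails K a b v e by rewrite inE.
  apply: pickPP; have ve : v \in endpoints e by move: ea; rewrite inE => /andP[].
  have alt1 : alt_trail K a b v e [set e].
    apply/asboolP; exists [:: e]; split=> //=.
    - by rewrite ve.
    - by rewrite /alternating /= Ke inE eqxx.
    - by apply/setP => f; rewrite !inE.
  have [S' maxS' _] := maxset_exists alt1.
  by apply/set0Pn; exists S'; rewrite inE.
split; first by rewrite flipE; apply: swapped_flip.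
have at_v f : f \in [set e1; e2] -> v \in endpoints f /\ K f = a.
  by rewrite -E inE => /andP[vf /eqP].
(* [d] is the edge of the repeated colour that was not drawn. *)
have [d [Hd de dE]] : exists d, [/\ d \in H, d != e & d \in [set e1; e2]].
  have [e1e|] := eqVneq e1 e; last by exists e1; rewrite set21.
  by exists e2; rewrite set22 -e1e eq_sym.
have He : e \in H.
  by move: ea; rewrite E => /set2P[] ->.
have [ve _] : v \in endpoints e /\ K e = a by apply: at_v; rewrite -E.
have [vd Kd] := at_v d dE.
have sub := clashes_flip_trail properC bipG sw bcc ab He ve Ke Hd de vd Kd maxS.
have vcl : v \in clashes K by apply: (subsetP (deficients_sub_clashes properC sw)).
apply: leq_ltn_trans (subset_leq_card sub) _.
by rewrite [X in (_ < X)%N](cardsD1 v) vcl.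
Qed.

Lemma elim_step_gap pal K K' :
  gap 2^-1 (elim_step pickV pickP pal K K').
Proof.
rewrite /elim_step; case: ifP => _.
  by apply: gap_le (gap_dirac _ _); lra.
rewrite -[2^-1]mul1r; apply: gap_unif => // [|e _]; last exact: gap_dirac.
exact: card_dup_edges.
Qed.

(** Each repair costs a factor 1/2 and lowers the number of clashes; an idle step costs nothing. The
    bound is thus independent of [m]. *)
Lemma elim_steps_gap pal m K C' : swapped K ->
  gap (2^-1 ^+ #|clashes K|) (elim_steps pickV pickP [:: c, c' & pal] m K C').
Proof.
elim: m K => [|m IHm] K sw /=.
  apply: gap_le (gap_dirac _ _); apply: exprn_ile1; lra.
have [D0|D0] := eqVneq (deficients K) set0.
  under eq_bigr do rewrite /elim_step D0 eqxx.
  by rewrite sum_dirac; apply: IHm.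
have half0 n : 0 <= 2^-1 ^+ n :> rat by apply: exprn_ge0; lra.
apply: gap_sum => // K' _.
have [->|ne] := eqVneq (elim_step pickV pickP [:: c, c' & pal] K K') 0.
  by left; rewrite mul0r.
have [sw' lt] := elim_step_neq0 sw D0 ne.
have h0 : 0 <= 2^-1 :> rat by lra.
have := gap_mul h0 (half0 _) (elim_step_gap [:: c, c' & pal] K K') (IHm _ sw').
by rewrite -exprS; apply: gap_le; rewrite ler_wiXn2l //; lra.
Qed.

Lemma eliminate_gap pal K C' : swapped K -> (#|clashes K| <= 2)%N ->
  gap 4^-1 (eliminate pickV pickP [:: c, c' & pal] K C').
Proof.
move=> sw le2; apply: gap_le (elim_steps_gap pal #|G| C' sw).
have -> : 4^-1 = 2^-1 ^+ 2 :> rat by lra.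
by rewrite ler_wiXn2l //; lra.
Qed.

Lemma eliminate_neq0 pal K C' : deficients K = set0 ->
  eliminate pickV pickP pal K C' != 0 -> K = C'.
Proof.
move=> D0; rewrite /eliminate; elim: #|G| => [|m IHm] /=.
  exact: dirac_neq0.
under eq_bigr do rewrite /elim_step D0 eqxx.
by rewrite sum_dirac.
Qed.

End Eliminate.

(** * Selection and perturbation *)

Section Moves.
Variables (G : sgraph) (k : nat) (C : color_map G k) (c c' : 'I_k).
Hypotheses (properC : edge_coloring C) (G_gt1 : (1 < #|G|)%N).
Implicit Types (K : color_map G k) (a b : 'I_k) (u v x : G).
Implicit Types (d e f : edge G) (S : {set edge G}) (A : {set {set edge G}}).

Local Notation H := (color_edges C c c').
Local Notation swapped := (swapped C c c').
Local Notation clashes := (clashes C c c').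
Let two_H : at_most_two H := color_edges_at_most_two c c' properC.
Let n_ge2 : 2 <= #|G|%:R :> rat. Proof. by rewrite ler_nat. Qed.

(* select2 and select3 are instances, differing in the family A only. *)
Definition select_among A : color_map G k -> rat := fun K =>
  3^-1 * dirac C K
  + 3^-1 * unif C A (fun S => dirac (flip C c c' S)) K
  + 3^-1 * unif C (path_pairs H)
             (fun P => dirac (flip C c c' (flipped_edges P))) K.

Lemma distr_select_among A : is_distr (select_among A).
Proof.
by apply: distr_mix3; [|apply: distr_unif => ? _..]; apply: distr_dirac.
Qed.

Lemma select_among_swapped A K : A \subset subpaths H :|: subcycles H ->
  select_among A K != 0 -> swapped K /\ (#|clashes K| <= 2)%N.
Proof.
move=> /subsetP subA ne.
(* All outcomes are flips of [C] along a set with at most two boundary vertices; doing nothing, and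
   an empty draw, are the flip along the empty set. *)
have [S <- bS] : exists2 S, flip C c c' S = K & (#|boundary C c c' S| <= 2)%N.
  have idle : C = K ->
      exists2 S, flip C c c' S = K & (#|boundary C c c' S| <= 2)%N.
    move=> <-; exists set0; first by apply/ffunP => e; rewrite ffunE inE.
    rewrite [boundary _ _ _ _](_ : _ = set0) ?cards0 //.
    by apply/setP => u; rewrite in_set0; apply/boundaryP => -[e1 [e2 [_]]]; rewrite in_set0.
  have := ne; have [dC|/dirac_neq0 //] := eqVneq (dirac C K) 0; last by move/idle.
  have [uA|/unif_neq0] := eqVneq (unif C A (fun S => dirac (flip C c c' S)) K) 0.
    rewrite /select_among dC uA !mulr0 !add0r mulf_eq0 negb_or => /andP[_].
    move=> /unif_neq0; case: ifP => _; first by move/idle.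
    move=> [P PP /dirac_neq0 <-]; exists (flipped_edges P) => //.
    exact: card_boundary_pair.
  case: ifP => _; first by move/idle.
  move=> [S /subA AS /dirac_neq0 <-] _; exists S => //.
  move: AS; rewrite inE => /orP[/subpath_trail|/subcycle_trail];
    by move=> [x [es [tr _ _ ->]]]; apply: (card_boundary_trail properC tr).
split; first exact/swapped_flip/swapped_refl.
exact: leq_trans (subset_leq_card (clashes_flip _ _ properC S)) bS.
Qed.

(** Each option has probability 1/3, followed by a draw from at most 2n^2 objects. *)
Lemma select_among_gap A K : A \subset subpaths H :|: subcycles H ->
  gap (6 * #|G|%:R ^+ 2)^-1 (select_among A K).
Proof.
have n2le := n_ge2; move=> subA; have n2 : (2 * #|G| ^ 2)%:R = 2 * #|G|%:R ^+ 2 :> rat.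
  by rewrite natrM natrX.
have sq1 : 1 <= #|G|%:R ^+ 2 :> rat by rewrite exprn_ege1 //; lra.
have n0 : 0 < 2 * #|G|%:R ^+ 2 :> rat by lra.
have i0 : 0 <= (2 * #|G|%:R ^+ 2)^-1 :> rat by rewrite invr_ge0 ltW.
have i1 : (2 * #|G|%:R ^+ 2)^-1 <= 1 :> rat by rewrite invf_le1 //; lra.
have third p : gap (2 * #|G|%:R ^+ 2)^-1 p -> gap (6 * #|G|%:R ^+ 2)^-1 (3^-1 * p).
  have -> : (6 * #|G|%:R ^+ 2)^-1 = 3^-1 * (2 * #|G|%:R ^+ 2)^-1 :> rat.
    by field; lra.
  by apply: gap_mul => //; right.
have g0 : 0 <= (6 * #|G|%:R ^+ 2)^-1 :> rat by rewrite invr_ge0; lra.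
have gu (I : finType) (B : {set I}) F : (#|B| <= 2 * #|G| ^ 2)%N ->
    (forall i, i \in B -> gap 1 (F i K)) ->
    gap (2 * #|G|%:R ^+ 2)^-1 (unif C B F K).
  move=> leB gF; rewrite -n2 -[_^-1]mul1r; apply: gap_unif => //.
  by rewrite muln_gt0 expn_gt0 (ltnW G_gt1).
apply: gap_add => //; first apply: gap_add => //; apply: third.
- exact: gap_le i1 (gap_dirac _ _).
- apply: gu => [|S _]; last exact: gap_dirac.
  exact: leq_trans (subset_leq_card subA) (card_subpaths_cycles two_H).
- by apply: gu => [|P _]; [apply: card_path_pairs | apply: gap_dirac].
Qed.

Lemma select_among_refl A : 3^-1 <= select_among A C.
Proof.
have u0 (I : finType) (B : {set I}) F : (forall i, is_distr (F i)) ->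
    0 <= unif C B F C by move=> dF; apply: (distr_unif _ _).1.
rewrite /select_among {1}/dirac eqxx.
have := u0 _ A (fun S => dirac (flip C c c' S)) (fun=> distr_dirac _).
have := u0 _ (path_pairs H) (fun P => dirac (flip C c c' (flipped_edges P)))
  (fun=> distr_dirac _).
by rewrite mulr1n; lra.
Qed.

Definition perturb_bound K : rat :=
  if deficients K == set0 then (4 * #|G|%:R)^-1 else (4 * (#|G|%:R - 1))^-1.

Let four_le : (4 * (#|G|%:R - 1))^-1 <= 4^-1 :> rat.
Proof. by have n2le := n_ge2; rewrite lef_pV2 ?posrE; lra. Qed.

(** Without deficiency, recolouring costs 1/2 and a draw from at most 2n edges. Otherwise one of at
    most two vertices and one of two edges are drawn, with probability at least 1/4. *)
Lemma perturb2_gap K K' : swapped K -> (#|clashes K| <= 2)%N ->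
  gap (perturb_bound K) (perturb2 c c' K K').
Proof.
have n2le := n_ge2; move=> sw le2; rewrite /perturb2 /perturb_bound; case: ifP => D0 /=.
  have n4 : (4 * #|G|%:R)^-1 = 2^-1 * (1 / (#|G| * 2)%:R) :> rat.
    by rewrite natrM; field; lra.
  have n40 : 0 <= (4 * #|G|%:R)^-1 :> rat by rewrite invr_ge0; lra.
  apply: gap_add => //.
    rewrite n4; apply: gap_mul; first lra.
    - by rewrite divr_ge0 ?ler0n.
    - by right.
    apply: gap_unif => // [||e _]; last exact: gap_dirac.
      by rewrite muln_gt0 (ltnW G_gt1).
    by rewrite (color_edges_swapped sw); apply: card_at_most_two.
  have : 2^-1 <= 2^-1 * dirac K K' \/ 2^-1 * dirac K K' = 0.
    by case: (gap_dirac K K') => [->|]; [right; lra | left; lra].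
  case=> [le|->]; [right; apply: le_trans le | by left].
  by rewrite lef_pV2 ?posrE; lra.
apply: gap_le four_le _.
have -> : 4^-1 = 1 / 2%:R / 2%:R :> rat by lra.
apply: gap_unif => // [|v _].
  exact: leq_trans (subset_leq_card (deficients_sub_clashes properC sw)) le2.
apply: gap_unif => // [|e _]; [exact: card_dup_edges | exact: gap_dirac].
Qed.

Variables (c'' : 'I_k) (pickP : color_map G k -> {set {set edge G}} -> {set edge G}).
Hypotheses (c''c : c'' != c) (c''c' : c'' != c').

Lemma perturb3_deficient_gap K K' (D : {set G}) : (0 < #|D|)%N ->
  gap (2 * #|D|%:R)^-1 (unif K D (perturb3_deficient pickP c'' K) K').
Proof.
move=> D0.
have -> : (2 * #|D|%:R)^-1 = 1 / 2%:R / #|D|%:R :> rat.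
  by rewrite invfM mul1r.
apply: gap_unif => // v _.
apply: gap_unif => // [|e _]; [exact: card_dup_edges | exact: gap_dirac].
Qed.

(** After the vertex, the [c'']-edge is unique because this colour is as in [C], and the second edge
    is one of at most two. *)
Lemma perturb3_nondeficient_gap m K K' : swapped K -> (0 < m)%N ->
  (#|candidates c c' c'' K| <= m)%N ->
  gap (2 * m%:R)^-1 (perturb3_nondeficient pickP c c' c'' K K').
Proof.
move=> sw m0 lem.
have -> : (2 * m%:R)^-1 = 1 / 2%:R / 1%:R / m%:R :> rat.
  by rewrite divr1 invfM mul1r.
apply: gap_unif => // v _.
apply: gap_unif => // [|e _].
  exact: (card_edges_at_swapped properC v sw c''c c''c').
apply: gap_unif => // [|f _]; last exact: gap_dirac.
exact: (card_edges_at_pair_swapped properC v sw).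
Qed.

(** Two deficient vertices give 1/4 and none gives 1/(2n). With one, a deficient selection gives 1/4
    and a non-deficient one 1/2 times 1/(2(n-1)), which is the critical value. *)
Lemma perturb3_gap K K' : swapped K -> (#|clashes K| <= 2)%N ->
  gap (perturb_bound K) (perturb3 pickP c c' c'' K K').
Proof.
have n2le := n_ge2; move=> sw le2; rewrite /perturb3 /perturb_bound -cards_eq0.
have leD := leq_trans (subset_leq_card (deficients_sub_clashes properC sw)) le2.
have n1 : 0 < 4 * (#|G|%:R - 1) :> rat by lra.
have [D2|D2] := ltnP 1 #|deficients K|.
  rewrite gtn_eqF ?(ltnW D2) //; apply: gap_le four_le _.
  have DE : #|deficients K| = 2%N by apply/eqP; rewrite eqn_leq leD.
  have := perturb3_deficient_gap K K' (D := deficients K).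
  by rewrite DE => /(_ isT); apply: gap_le; lra.
have [D1|D1] := eqVneq #|deficients K| 1%N; last first.
  have -> : #|deficients K| == 0%N by move: D1 D2; case: #|_| => [|[]].
  have n0 : (0 < #|G|)%N := ltnW G_gt1.
  apply: gap_le (perturb3_nondeficient_gap K' sw n0 (max_card _)).
  by rewrite lef_pV2 ?posrE; lra.
rewrite D1 /=.
(* Candidates are non-deficient, which excludes the one deficient vertex. *)
have cand : (#|candidates c c' c'' K| <= #|G|.-1)%N.
  have -> : #|G|.-1 = #|~: deficients K|.
    by rewrite -(cardsC (deficients K)) D1.
  by apply/subset_leq_card/subsetP => v; rewrite !inE => /and3P[].
have p0 : 0 <= (4 * (#|G|%:R - 1))^-1 :> rat by rewrite invr_ge0 ltW.
have predE : #|G|.-1%:R = #|G|%:R - 1 :> rat.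
  by rewrite -[in RHS](prednK (ltnW G_gt1)) -addn1 natrD addrK.
have half : 0 <= 2^-1 :> rat by lra.
apply: gap_add => //.
  have := @perturb3_deficient_gap K K' (deficients K); rewrite D1 => /(_ isT).
  have d0 : 0 <= (2 * 1)^-1 :> rat by lra.
  move=> /(gap_mul half d0 (or_intror (lexx _))).
  apply: gap_le; apply: le_trans four_le _; lra.
have pn0 : (0 < #|G|.-1)%N by rewrite -ltnS (prednK (ltnW G_gt1)).
have d0 : 0 <= (2 * #|G|.-1%:R)^-1 :> rat by rewrite invr_ge0 predE; lra.
have := perturb3_nondeficient_gap K' sw pn0 cand.
move=> /(gap_mul half d0 (or_intror (lexx _))); apply: gap_le.
by rewrite -invfM mulrA predE lef_pV2 ?posrE //; lra.
Qed.

End Moves.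

(** * The acceptance ratio *)

Lemma distr_prob (T : finType) (p : T -> rat) y : is_distr p -> 0 <= p y <= 1.
Proof. by move=> dp; rewrite (proj1 dp) distr_le1. Qed.

Lemma perturb2_prob (G : sgraph) (k : nat) (c c' : 'I_k) (K K' : color_map G k) :
  0 <= perturb2 c c' K K' <= 1.
Proof.
rewrite /perturb2; case: ifP => _; last apply: (distr_prob _ (distr_mix2 _ _)).
- by apply/distr_prob/distr_unif => v _; apply: distr_unif => e _; apply: distr_dirac.
- by apply: distr_unif => e _; apply: distr_dirac.
- exact: distr_dirac.
Qed.

Lemma perturb3_prob (G : sgraph) (k : nat) pickP (c c' c'' : 'I_k)
    (K K' : color_map G k) : 0 <= perturb3 pickP c c' c'' K K' <= 1.
Proof.
have dD : is_distr (unif K (deficients K) (perturb3_deficient pickP c'' K)).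
  by apply: distr_unif => v _; apply: distr_unif => e _; apply: distr_dirac.
have dN : is_distr (perturb3_nondeficient pickP c c' c'' K).
  apply: distr_unif => v _; apply: distr_unif => e _.
  by apply: distr_unif => f _; apply: distr_dirac.
rewrite /perturb3; case: ifP => _; first exact: distr_prob.
case: ifP => _; last exact: distr_prob.
exact: (distr_prob _ (distr_mix2 dD dN)).
Qed.

Lemma eliminate_prob (G : sgraph) (k : nat) pickV pickP pal
    (K C : color_map G k) : 0 <= eliminate pickV pickP pal K C <= 1.
Proof.
apply: distr_prob; rewrite /eliminate; elim: #|G| K => [|m IHm] K /=.
  exact: distr_dirac.
apply: distr_bind => //; rewrite /elim_step; case: ifP => _.
  exact: distr_dirac.
by apply: distr_unif => e _; apply: distr_dirac.
Qed.

(** [D] says that the map in question has no deficient vertex. If it has one, the three bounds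
    multiply exactly to the inverse of 96n^2(n-1); if not, they give 1/(48n), which is larger. *)
Lemma backward_bound (n : rat) (D : bool) (S f E : rat) : 2 <= n ->
  gap (if D then 3^-1 else (6 * n ^+ 2)^-1) S ->
  gap (if D then (4 * n)^-1 else (4 * (n - 1))^-1) f ->
  gap 4^-1 E -> S * f * E != 0 -> 1 <= 96 * n ^+ 2 * (n - 1) * (S * f * E).
Proof.
move=> n2 gS gf gE ne.
have n0 : 0 < n by lra.
have n1 : 0 < n - 1 by lra.
have sq : 4 <= n ^+ 2 by nra.
have cube : 0 < n ^+ 2 * (n - 1) by apply: mulr_gt0 => //; lra.
pose s := if D then 3^-1 else (6 * n ^+ 2)^-1.
pose q := if D then (4 * n)^-1 else (4 * (n - 1))^-1.
have s0 : 0 < s by rewrite /s; case: D {gS gf s q}; rewrite invr_gt0; lra.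
have q0 : 0 < q by rewrite /q; case: D {gS gf s s0 q}; rewrite invr_gt0; lra.
have four0 : 0 <= 4^-1 :> rat by lra.
have gP := gap_mul (ltW (mulr_gt0 s0 q0)) four0
  (gap_mul (ltW s0) (ltW q0) gS gf) gE.
have B0 : 0 <= 96 * n ^+ 2 * (n - 1) by rewrite -mulrA; lra.
case: gP => [e0|le]; first by case/eqP: ne.
have := ler_wpM2l B0 le; apply: le_trans.
rewrite /s /q; case: (D).
  have -> : 96 * n ^+ 2 * (n - 1) * (3^-1 * (4 * n)^-1 * 4^-1) = 2 * (n * (n - 1)).
    by field; rewrite gt_eqF.
  by nra.
have -> : 96 * n ^+ 2 * (n - 1) * ((6 * n ^+ 2)^-1 * (4 * (n - 1))^-1 * 4^-1) = 1.
  by field; rewrite !gt_eqF.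
by [].
Qed.

Lemma inv_acceptance_le (a P P' B : rat) : 0 < a -> 0 < P -> 0 < P' -> 1 <= B ->
  P <= B * P' -> (Num.min 1 ((a * P') / (a * P)))^-1 <= B.
Proof.
move=> a0 P0 P'0 B1 le; rewrite /Order.min; case: ifP => _; first by rewrite invr1.
by rewrite -mulf_div divff ?gt_eqF // mul1r invf_div ler_pdivrMr.
Qed.

Section WayGaps.
Variables (G : sgraph) (k : nat) (C1 C2 K1 K2 : color_map G k) (c c' : 'I_k).
Variables (pickV : color_map G k -> {set G} -> G)
          (pickP : color_map G k -> {set {set edge G}} -> {set edge G}).
Variables (A1 A2 : {set {set edge G}}) (pal : seq 'I_k).
Hypotheses (bipG : bipartite G) (G_gt1 : (1 < #|G|)%N) (cc' : c != c').
Hypotheses (pickVP : forall K D, D != set0 -> pickV K D \in D)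
           (pickPP : forall K F, F != set0 -> pickP K F \in F).
Hypotheses (proper1 : edge_coloring C1) (proper2 : edge_coloring C2).
Local Notation H1 := (color_edges C1 c c').
Local Notation H2 := (color_edges C2 c c').
Hypotheses (subA1 : A1 \subset subpaths H1 :|: subcycles H1)
           (subA2 : A2 \subset subpaths H2 :|: subcycles H2).
Hypotheses (S1 : select_among C1 c c' A1 K1 != 0)
           (S2 : select_among C2 c c' A2 K2 != 0)
           (E1 : eliminate pickV pickP [:: c, c' & pal] K2 C2 != 0).

(** Uses both directions: the selection of the way makes [K1] a flip of [C1], so that the inverse
    elimination from [K1] to [C1] has at most two clashes to repair. *)
Lemma inverse_way_gaps :
  [/\ swapped C2 c c' K2, (#|clashes C2 c c' K2| <= 2)%N,
      gap (if deficients K2 == set0 then 3^-1 else (6 * #|G|%:R ^+ 2)^-1)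
        (select_among C2 c c' A2 K2)
    & gap 4^-1 (eliminate pickV pickP [:: c, c' & pal] K1 C1)].
Proof.
have [sw1 cl1] := select_among_swapped proper1 subA1 S1.
have [sw2 cl2] := select_among_swapped proper2 subA2 S2.
split=> //; last exact: (eliminate_gap proper1 cc' bipG pickVP pickPP pal C1 sw1 cl1).
case: ifP => [/eqP D0|_]; last exact: select_among_gap.
(* Without deficiency in [K2] the elimination of the way is idle, so [K2 = C2] and the inverse way
   may select nothing, with probability 1/3. *)
by right; rewrite (eliminate_neq0 D0 E1); apply: select_among_refl.
Qed.

End WayGaps.

(* S, f, E are the probabilities of the three transformations of the inverse way
   and S', f', E' those of the way itself; x is the probability of the colours,
   which is common to both. *)
Lemma way_bound (n x : rat) (D : bool) (S f E S' f' E' : rat) : 2 <= n ->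
  gap (if D then 3^-1 else (6 * n ^+ 2)^-1) S ->
  gap (if D then (4 * n)^-1 else (4 * (n - 1))^-1) f -> gap 4^-1 E ->
  0 <= x -> 0 < x * (S * f * E) ->
  0 <= S' <= 1 -> 0 <= f' <= 1 -> 0 <= E' <= 1 ->
  x * (S' * f' * E') <= 96 * n ^+ 2 * (n - 1) * (x * (S * f * E)).
Proof.
move=> n2 gS gf gE x0 pos /andP[S0 S1] /andP[f0 f1] /andP[E0 E1].
have ne : S * f * E != 0.
  by apply: contraTneq pos => ->; rewrite mulr0 ltxx.
rewrite [X in _ <= X]mulrCA; apply: (ler_wpM2l x0).
apply: (le_trans _ (backward_bound n2 gS gf gE ne)).
by apply: mulr_ile1 => //; [apply: mulr_ge0 | apply: mulr_ile1].
Qed.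

Lemma if_gt0 (b : bool) (p : rat) : 0 < (if b then p else 0) -> b /\ 0 < p.
Proof. by case: b => //; rewrite ltxx. Qed.

Lemma factors_neq0 (x S f E : rat) : 0 < x * (S * f * E) -> S != 0 /\ E != 0.
Proof.
by move=> /lt0r_neq0; rewrite !(mulf_eq0, negb_or) => /and3P[_ /andP[-> _] ->].
Qed.

(** [pickV] and [pickP] are arbitrary selectors, so the bound holds for every order of repair and
    every choice among maximal paths. The constant function of the algorithm has value [a]. *)
Theorem theorem3p2 (G : sgraph) (k : nat)
    (pickV : color_map G k -> {set G} -> G)
    (pickP : color_map G k -> {set {set edge G}} -> {set edge G})
    (a : rat) (C1 C2 : color_map G k) (w : way G k) :
  bipartite G ->
  (max_degree G <= k)%N ->
  (1 < #|G|)%N ->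
  (forall K D, D != set0 -> pickV K D \in D) ->
  (forall K F, F != set0 -> pickP K F \in F) ->
  0 < a ->
  edge_coloring C1 ->
  edge_coloring C2 ->
  0 < proposal_prob pickV pickP w C1 C2 ->
  0 < proposal_prob pickV pickP (inverse_way w) C2 C1 ->
  (MH_acceptance (proposal_prob pickV pickP) (@inverse_way G k)
     (fun=> a) w C1 C2)^-1
    <= 96 * #|G|%:R ^+ 2 * (#|G|%:R - 1).
Proof.
move=> bipG _ G_gt1 pickVP pickPP a0 proper1 proper2 P0 P'0.
have n2 : 2 <= #|G|%:R :> rat by rewrite ler_nat.
(* Covers the case in which the minimum with 1 is attained by 1; it relies on there being at least
   two vertices. *)
have B1 : 1 <= 96 * #|G|%:R ^+ 2 * (#|G|%:R - 1) :> rat.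
  have sq : 1 <= #|G|%:R ^+ 2 :> rat by rewrite exprn_ege1 //; lra.
  by nra.
rewrite /MH_acceptance; apply: (inv_acceptance_le a0 P0 P'0 B1).
case: w P0 P'0 => [|c c' K1 K2|c c' c'' K1 K2] /=.
- move=> _ P'0; have -> : dirac C1 C2 = dirac C2 C1 by rewrite /dirac eq_sym.
  exact: (ler_peMl (ltW P'0) B1).
- move=> /if_gt0[lt P0] /if_gt0[_ P'0]; rewrite lt.
  have cc' : c != c' by rewrite neq_ltn lt.
  have x0 : 0 <= 4^-1 * ('C(k, 2)%:R)^-1 :> rat by rewrite mulr_ge0 ?invr_ge0 ?ler0n.
  have [S1 E1] := factors_neq0 P0; have [S2 _] := factors_neq0 P'0.
  have [sw2 cl2 gS gE] := inverse_way_gaps bipG G_gt1 cc' pickVP pickPP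
    proper1 proper2 (subxx _) (subxx _) S1 S2 E1.
  apply: (way_bound n2 gS (perturb2_gap proper2 G_gt1 K1 sw2 cl2) gE x0 P'0).
  + exact: distr_prob (distr_select_among _ _ _ _).
  + exact: perturb2_prob.
  + exact: eliminate_prob.
- move=> /if_gt0[cols P0] /if_gt0[_ P'0]; rewrite cols.
  case/and3P: cols => lt c''c c''c'.
  have cc' : c != c' by rewrite neq_ltn lt.
  have x0 : 0 <= 4^-1 * ('C(k, 3)%:R)^-1 * 3^-1 :> rat.
    by rewrite !mulr_ge0 ?invr_ge0 ?ler0n.
  have [S1 E1] := factors_neq0 P0; have [S2 _] := factors_neq0 P'0.
  have inner (C : color_map G k) : inner_end_paths (color_edges C c c')
      \subset subpaths (color_edges C c c') :|: subcycles (color_edges C c c').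
    by apply/subsetP => S; rewrite inE => /andP[SH _]; rewrite inE SH.
  have [sw2 cl2 gS gE] := inverse_way_gaps bipG G_gt1 cc' pickVP pickPP
    proper1 proper2 (inner C1) (inner C2) S1 S2 E1.
  apply: (way_bound n2 gS (perturb3_gap proper2 G_gt1 pickP c''c c''c' K1 sw2 cl2) gE x0 P'0).
  + exact: distr_prob (distr_select_among _ _ _ _).
  + exact: perturb3_prob.
  + exact: eliminate_prob.
Qed.
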